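(* For the alternating group $A_n$ with $n\geq 4$: (1) the number of conjugacy classes of $A_n$ which are rational is $cl(A_n)-2q(n)+2\delta(n)$; and (2) the number of rational classes of $A_n$ is $cl(A_n)-q(n)+\delta(n)$.
   Context: $cl(A_n)$ is the number of conjugacy classes of $A_n$; $q(n)$ is the number of partitions of $n$ with all parts distinct and odd; $\delta(n)$ is the number of partitions of $n$ with all parts distinct and odd and such that the product of the parts is a perfect square. Let $G$ be a finite group and let $o(g)$ denote the order of $g\in G$. An element $g\in G$ is rational if $g$ is conjugate in $G$ to $g^m$ for every integer $m$ with $(m,o(g))=1$; a conjugacy class is rational if it is the class of a rational element. The rational class of $g\in G$ is the set of all elements of $G$ conjugate in $G$ to $g^m$ for some $m$ with $(m,o(g))=1$; the rational classes partition $G$. *)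

(* Defs.v *)
From HB Require Import structures.
From mathcomp Require Import all_boot all_order all_algebra all_fingroup all_solvable.
From mathcomp Require Import boolp.

Set Implicit Arguments.
Unset Strict Implicit.
Unset Printing Implicit Defensive.

Import GroupScope.

Section RationalClasses.

Variable gT : finGroupType.
Implicit Types (G : {group gT}) (g h : gT) (C : {set gT}).

Definition expgz g (m : int) : gT :=
  match m with
  | Posz k => g ^+ k
  | Negz k => g ^- k.+1
  end.

Definition rational_elt G g : Prop :=
  g \in G /\ forall m : int, coprimez m (#[g])%:Z -> expgz g m \in g ^: G.

Definition rational_conj_classes G : {set {set gT}} :=
  [set C in classes G | `[< exists g, rational_elt G g /\ C = g ^: G >]].

Definition rational_class_of G g : {set gT} :=
  [set h in G |
    `[< exists m : int, coprimez m (#[g])%:Z /\ h \in expgz g m ^: G >]].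

Definition rational_classes G : {set {set gT}} :=
  [set rational_class_of G g | g in G].

End RationalClasses.

Definition cl (gT : finGroupType) (G : {group gT}) : nat := #|classes G|.

(* Partitions of n are the non-increasing sequences of positive integers      *)
(* with sum n.                                                                *)
Definition is_partition (n : nat) (s : seq nat) : bool :=
  [&& sorted geq s, 0 \notin s & sumn s == n].

Definition is_square (m : nat) : bool := [exists k : 'I_m.+1, k ^ 2 == m]%N.

(* To count partitions, they are taken in the finite type of sequences of     *)
(* length at most n with entries at most n; partition_bseq below shows that   *)
(* every partition of n arises, and the coding is injective.                  *)
Definition bseq_parts (n : nat) (p : n.-bseq 'I_n.+1) : seq nat := map val p.

Definition distinct_odd_partitions (n : nat) : {set n.-bseq 'I_n.+1} :=
  [set p | [&& is_partition n (bseq_parts p), uniq (bseq_parts p)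
             & all odd (bseq_parts p)]].

Definition q (n : nat) : nat := #|distinct_odd_partitions n|.

Definition delta (n : nat) : nat :=
  #|[set p in distinct_odd_partitions n |
      is_square (\prod_(k <- bseq_parts p) k)%N]|.

Lemma is_squareP (m : nat) : reflect (exists k : nat, m = k ^ 2)%N (is_square m).
Proof.
apply: (iffP existsP) => [[k /eqP Ek]|[k Ek]]; first by exists k.
have km : (k < m.+1)%N by rewrite ltnS Ek; case: k {Ek} => // k; rewrite leq_pmulr.
by exists (Ordinal km); rewrite /= -Ek.
Qed.

Lemma bseq_parts_inj (n : nat) : injective (@bseq_parts n).
Proof. by move=> p1 p2 /(inj_map val_inj) /val_inj. Qed.

Lemma partition_bseq (n : nat) (s : seq nat) :
  is_partition n s -> exists p : n.-bseq 'I_n.+1, bseq_parts p = s.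
Proof.
case/and3P=> _ s0 /eqP sn.
have le_part : all (fun x => x < n.+1)%N s.
  apply/allP=> x xs; rewrite ltnS -sn sumnE (big_rem x) //=.
  exact: leq_addr.
have size_s : (size s <= n)%N.
  rewrite -sn; elim: s s0 {sn le_part} => //= x s IHs.
  rewrite inE negb_or eq_sym -lt0n => /andP[x0 /IHs IH].
  by rewrite -add1n leq_add.
have sz : (size (map (@inord n) s) <= n)%N by rewrite size_map.
exists (Bseq sz); rewrite /bseq_parts /= -map_comp map_id_in // => x xs /=.
by rewrite inordK // (allP le_part).
Qed.

(* Main.v *)
Require Import Defs.
From mathcomp Require Import all_boot all_order all_algebra all_fingroup all_solvable.
From mathcomp Require Import boolp zify.

Set Implicit Arguments.
Unset Strict Implicit.
Unset Printing Implicit Defensive.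

(** Let k be the number of classes of S_n that contain an element of A_n
which is not rational in A_n.  Both counts come from k, and k = q(n) - delta(n).

The first half only uses that A_n has index two in S_n and that every g is
conjugate in S_n to its powers g^m with m prime to the order of g
(alt_power_conj), because g^m has the same orbits as g.  Let H have index two
in G, with the same property.  If g in H is irrational in H, then some g^m is
g^x with x in G but only with x outside H; an element outside H commuting with
g would correct x to an element of H, so the centraliser of g lies in H.  Hence
the G-class of g is the union of two H-classes, and g^m lies in the one that
does not contain g: the two H-classes form a single rational class.  A rational
element has its H-class as rational class.  With k irrational G-classes, there
are cl(H) - 2k rational H-classes and (cl(H) - 2k) + k rational classes
(card_rational_conj_classes, card_rational_classes).

The second half determines the irrational elements g of A_n by their cycle
lengths (irrational_AltP).  An even cycle of g, or two cycles of equal length,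
provide an odd permutation that commutes with g, so g is rational.  Otherwise
the lengths are distinct and odd, and only even permutations commute with g
(centraliser_even), so all permutations conjugating g to g^m have the same
sign.  One of them acts on each cycle of length l, identified with Z/l, as
multiplication by m.  The sign of this multiplication is the Jacobi symbol
(Zolotarev), but only two properties of it matter: it is multiplicative in l
(mul_signM), so that the total sign is that of multiplication by m modulo the
product N of the lengths; and it is -1 for a primitive root m modulo an odd
prime.  If N is a square, the total sign is always +1 and g is rational.  If
not, some prime p divides N to an odd power, and an m that is a primitive root
modulo p and 1 modulo the part of N prime to p gives the sign -1
(mul_sign_nonsquare), so g is irrational.

Permutations with the same distinct cycle lengths are conjugate
(conj_same_sizes) and every partition of n occurs (perm_of_cycle_sizes).  So k
is the number of partitions of n into distinct odd parts whose product is not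
a square, which is q(n) - delta(n). *)

(** * Rationality in a subgroup of index two *)

Section IndexTwo.

Import GroupScope.

(** Since g has finite order, exponents in nat do the work of those in int. *)
Lemma expgz_nat (gT : finGroupType) (g : gT) (z : int) :
  coprimez z #[g]%:Z ->
  exists2 k : nat, coprime k #[g] & expgz g z = g ^+ k.
Proof.
rewrite coprimezE /=; case: z => k /= co; first by exists k.
exists (k.+1 * #[g].-1)%N.
  by rewrite coprimeMl co -{2}(prednK (order_gt0 g)) coprimenS.
have Eo : g ^+ #[g].-1 = g^-1.
  by apply/esym/(mulgI g); rewrite mulgV -expgS prednK ?expg_order.
by rewrite mulnC expgM Eo expgVn.
Qed.

Lemma rational_eltP (gT : finGroupType) (G : {group gT}) (g : gT) :
  rational_elt G g <->
  g \in G /\ forall m, coprime m #[g] -> g ^+ m \in g ^: G.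
Proof.
split=> -[gG rat]; split=> // m co.
  by have /= := rat (Posz m); apply; rewrite coprimezE.
by have [k cok ->] := expgz_nat co; apply: rat.
Qed.

Lemma rational_class_ofP (gT : finGroupType) (G : {group gT}) (g h : gT) :
  reflect (h \in G /\ exists2 m, coprime m #[g] & h \in (g ^+ m) ^: G)
          (h \in rational_class_of G g).
Proof.
rewrite inE; apply: (iffP andP) => -[hG].
  move=> /asboolP[z [co hz]]; split=> //.
  by have [k cok Ek] := expgz_nat co; exists k; rewrite // -Ek.
case=> m co hm; split=> //; apply/asboolP; exists (Posz m).
by rewrite coprimezE.
Qed.

Variables (gT : finGroupType) (G H : {group gT}).
Hypotheses (nHG : H <| G) (iHG : #|G : H| = 2).
Hypothesis pow_conj :
  forall g m, g \in H -> coprime m #[g] -> g ^+ m \in g ^: G.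

Definition irrational_elts : {set gT} :=
  [set g in H | `[< ~ rational_elt H g >]].

Lemma irrationalP g :
  reflect (g \in H /\ exists2 m, coprime m #[g] & g ^+ m \notin g ^: H)
          (g \in irrational_elts).
Proof.
rewrite inE; apply: (iffP andP) => -[gH].
  move=> /asboolP nrat; split=> //.
  apply: contrapT => nex; apply: nrat; apply/rational_eltP; split=> // m co.
  by apply: contrapT => /negP gm; apply: nex; exists m.
case=> m co gm; split=> //; apply/asboolP => /rational_eltP[_ rat].
by rewrite rat in gm.
Qed.

Let sHG : H \subset G := normal_sub nHG.

Lemma split_index2 t x : t \in G :\: H -> x \in G ->
  x \in H \/ exists2 y, y \in H & x = t * y.
Proof.
move=> tGH xG; have [xH | xnH] := boolP (x \in H); [by left | right].
have /setDP[tG tnH] := tGH.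
have: x \in H :* t by rewrite (rcoset_index2 sHG iHG tGH) inE xnH.
rewrite norm_rlcoset ?(subsetP (normal_norm nHG)) //.
by case/lcosetP=> y yH ->; exists y.
Qed.

(** Each coprime power of g is some g ^ x with x in G; an element outside H
commuting with g would allow x to be taken in H, making g rational. *)
Lemma cent_irrational g x : g \in irrational_elts -> x \in G ->
  g ^ x = g -> x \in H.
Proof.
case/irrationalP=> gH [m co gm] xG gx; apply: contraNT gm => xnH.
have [y yG ->] := imsetP (pow_conj gH co).
have [] := split_index2 (t := x) (x := y); rewrite ?inE ?xnH //.
  by move=> yH; apply: imset_f.
by case=> z zH ->; rewrite conjgM gx imset_f.
Qed.

Lemma class_split g t : g \in irrational_elts -> t \in G :\: H ->
  g ^: G = g ^: H :|: (g ^ t) ^: H.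
Proof.
move=> gN tGH; have /setDP[tG tnH] := tGH.
apply/setP=> u; rewrite inE; apply/imsetP/orP.
  case=> x xG ->; have [xH|[y yH ->]] := split_index2 tGH xG.
    by left; apply: imset_f.
  by right; rewrite conjgM imset_f.
case=> /imsetP[x /(subsetP sHG) xG ->]; first by exists x.
by exists (t * x); rewrite ?groupM ?conjgM.
Qed.

Lemma class_split_neq g t : g \in irrational_elts -> t \in G :\: H ->
  g ^ t \notin g ^: H.
Proof.
move=> gN /setDP[tG tnH]; apply: contra tnH => /imsetP[x xH gtx].
have xG := subsetP sHG x xH.
have: t * x^-1 \in H.
  apply: (cent_irrational gN); first by rewrite groupM ?groupV.
  by rewrite conjgM gtx -conjgM mulgV conjg1.
by rewrite groupMr ?groupV.
Qed.

Lemma irrationalJ g x : x \in G -> g \in irrational_elts ->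
  g ^ x \in irrational_elts.
Proof.
move=> xG /irrationalP[gH [m co gm]]; apply/irrationalP.
have xN := subsetP (normal_norm nHG) x xG.
split; first by rewrite memJ_norm.
exists m; rewrite ?orderJ //; apply: contra gm => /imsetP[y yH].
rewrite -conjXg -conjgM => /(canRL (conjgK x)) ->; rewrite -conjgM.
by rewrite imset_f // -mulgA -[x in x * _]invgK -conjgE memJ_norm ?groupV.
Qed.

(** A power of g conjugate to g in G but not in H reaches the second half of
the G-class of g. *)
Lemma rational_class_irr g : g \in irrational_elts ->
  rational_class_of H g = g ^: G.
Proof.
move=> gN; have /irrationalP[gH [m co gm]] := gN.
apply/setP=> h; apply/rational_class_ofP/idP => [[hH [k cok /imsetP[x xH ->]]]|].
  have [y yG ->] := imsetP (pow_conj gH cok).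
  by rewrite -conjgM imset_f // groupM // (subsetP sHG).
have [x xG gx] := imsetP (pow_conj gH co).
have xGH : x \in G :\: H.
  by rewrite inE xG andbT; apply: contra gm => xH; rewrite gx imset_f.
move=> hg; split.
  have [y yG ->] := imsetP hg.
  by rewrite memJ_norm // (subsetP (normal_norm nHG)).
move: hg; rewrite (class_split gN xGH) -gx => /setUP[] hm; last by exists m.
by exists 1%N; rewrite ?coprime1n ?expg1.
Qed.

Lemma rational_class_rat g : rational_elt H g -> rational_class_of H g = g ^: H.
Proof.
move=> /rational_eltP[gH rat]; apply/setP=> h.
apply/rational_class_ofP/idP => [[hH [k cok]]|hg].
  by rewrite (class_eqP (rat k cok)).
split; last by exists 1%N; rewrite ?coprime1n ?expg1.
by have [y yG ->] := imsetP hg; rewrite groupJ.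
Qed.

Definition rational_elts : {set gT} := H :\: irrational_elts.

Lemma rational_eltsP g : reflect (rational_elt H g) (g \in rational_elts).
Proof.
rewrite !inE; apply: (iffP andP) => [[] | rat].
  rewrite negb_and => /orP[/negP // | /asboolPn nn _].
  exact: contrapT.
have gH : g \in H by case: rat.
by split; rewrite // gH /=; apply/asboolPn.
Qed.

Let class_of (K : {group gT}) (g : gT) : {set gT} := g ^: K.

Lemma rational_conj_classesE :
  rational_conj_classes H = class_of H @: rational_elts.
Proof.
apply/setP=> C; rewrite inE; apply/andP/imsetP.
  by case=> _ /asboolP[g [/rational_eltsP rat ->]]; exists g.
case=> g /rational_eltsP rat ->; split; last by apply/asboolP; exists g.
by apply: imset_f; case: rat.
Qed.

Lemma rationalU : H :=: rational_elts :|: irrational_elts.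
Proof.
rewrite /rational_elts setDE setUIl [~: _ :|: _]setUC setUCr setIT.
by apply/esym/setUidPl/subsetP=> g; rewrite inE => /andP[].
Qed.

Lemma classes_rational_irrational :
  classes H = class_of H @: rational_elts :|: class_of H @: irrational_elts.
Proof.
by rewrite -imsetU -rationalU.
Qed.

Lemma class_of_disjoint (K : {group gT}) : H \subset K -> K \subset G ->
  [disjoint class_of H @: rational_elts & class_of K @: irrational_elts].
Proof.
move=> sHK sKG; apply/pred0P=> C /=; apply/negP=> /andP[/imsetP[g gR ->]].
case/imsetP=> h hN E; have: g \in class_of K h by rewrite -E class_refl.
case/imsetP=> x xK gx.
by move: gR; rewrite gx inE irrationalJ // (subsetP sKG).
Qed.

Lemma rational_classesE :
  rational_classes H = class_of H @: rational_elts :|: class_of G @: irrational_elts.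
Proof.
rewrite /rational_classes.
have -> : rational_class_of H @: H
        = rational_class_of H @: (rational_elts :|: irrational_elts).
  by rewrite -rationalU.
rewrite imsetU; congr (_ :|: _); apply: eq_in_imset => g.
  by move/rational_eltsP/rational_class_rat.
exact: rational_class_irr.
Qed.

(** Fix t outside H.  The H-classes of g and of g ^ t, for g running over
representatives of the irrational G-classes, are two disjoint copies of the set
of these G-classes. *)
Lemma card_irrational_classes :
  #|class_of H @: irrational_elts| = (2 * #|class_of G @: irrational_elts|)%N.
Proof.
have [t tGH] : exists t, t \in G :\: H.
  apply/set0Pn; rewrite setD_eq0; apply/negP=> sGH.
  by have: #|G : H| = 1%N by [apply/eqP; rewrite indexg_eq1]; rewrite iHG.
have /setDP[tG _] := tGH.
set Q := class_of G @: irrational_elts.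
have reprQ C : C \in Q -> repr C \in irrational_elts /\ class_of G (repr C) = C.
  case/imsetP=> g gN ->; rewrite /class_of.
  have [x xG ->] := repr_class G g.
  by split; [exact: irrationalJ | rewrite classGidl].
pose F (b : bool) (C : {set gT}) := class_of H (repr C ^ (if b then t else 1)).
have FG b C : C \in Q -> F b C \subset C.
  move=> /reprQ[_ {2}<-]; apply/subsetP=> _ /imsetP[x xH ->].
  by rewrite -conjgM imset_f //; apply: groupM; [case: b | apply: (subsetP sHG)].
have Finj b : {in Q &, injective (F b)}.
  move=> C D CQ DQ E; have [CN EC] := reprQ C CQ; have [DN ED] := reprQ D DQ.
  set u := repr C ^ (if b then t else 1).
  have uC : u \in C by rewrite (subsetP (FG b C CQ)) // class_refl.
  have uD : u \in D by rewrite (subsetP (FG b D DQ)) // -E class_refl.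
  have /class_eqP uC' : u \in repr C ^: G by rewrite -EC in uC.
  have /class_eqP uD' : u \in repr D ^: G by rewrite -ED in uD.
  by rewrite -[LHS]EC -[RHS]ED /class_of -uC' -uD'.
have -> : class_of H @: irrational_elts = F false @: Q :|: F true @: Q.
  apply/setP=> C; apply/imsetP/setUP.
    case=> g gN ->; pose D := class_of G g; have DQ : D \in Q by apply: imset_f.
    have [DN ED] := reprQ D DQ.
    have: g \in class_of G (repr D) by rewrite ED class_refl.
    rewrite /class_of (class_split DN tGH) => /setUP[] /class_eqP E.
      by left; apply/imsetP; exists D; rewrite // /F conjg1.
    by right; apply/imsetP; exists D.
  by case=> /imsetP[D /reprQ[DN ED] ->];
     [exists (repr D ^ 1) | exists (repr D ^ t)]; rewrite ?irrationalJ.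
have dis : [disjoint F false @: Q & F true @: Q]; last first.
  rewrite cardsU disjoint_setI0 // cards0 subn0.
  by rewrite (card_in_imset (Finj false)) (card_in_imset (Finj true)) mul2n addnn.
apply/pred0P=> C /=; apply/negP=> /andP[/imsetP[D DQ ->] /imsetP[D' DQ' E]].
have [DN ED] := reprQ D DQ; have [DN' ED'] := reprQ D' DQ'.
have u1 : repr D \in F false D by rewrite /F conjg1 class_refl.
have EDD : D = D'.
  have uD : repr D \in D by rewrite (subsetP (FG false D DQ)).
  have uD' : repr D \in D' by rewrite (subsetP (FG true D' DQ')) // -E.
  have /class_eqP E' : repr D \in repr D' ^: G by rewrite -ED' in uD'.
  by rewrite -[LHS]ED -[RHS]ED' /class_of E'.
have: repr D ^ t \in F false D by rewrite E -EDD class_refl.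
by rewrite /F conjg1 (negPf (class_split_neq DN tGH)).
Qed.

Let k := #|class_of G @: irrational_elts|.

Lemma card_rational_conj_classes : (#|rational_conj_classes H| + 2 * k)%N = cl H.
Proof.
rewrite rational_conj_classesE /k -card_irrational_classes /cl.
rewrite classes_rational_irrational cardsU disjoint_setI0 ?cards0 ?subn0 //.
exact: class_of_disjoint.
Qed.

Lemma card_rational_classes : (#|rational_classes H| + k)%N = cl H.
Proof.
rewrite -card_rational_conj_classes rational_conj_classesE rational_classesE.
rewrite cardsU disjoint_setI0 ?cards0 ?subn0; last exact: class_of_disjoint.
by rewrite -addnA mul2n addnn.
Qed.

End IndexTwo.

(** * Cycles and signs of permutations *)

Section Cycles.

Local Open Scope group_scope.

Lemma eq_permX (T : finType) (g : {perm T}) x i j :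
  ((g ^+ i) x == (g ^+ j) x) = (i == j %[mod #|porbit g x|]).
Proof.
set k := #|porbit g x|.
have k_gt0 : (0 < k)%N by rewrite lt0n card_porbit_neq0.
have red m : (g ^+ m) x = nth x (traject g x k) (m %% k).
  rewrite nth_traject ?ltn_pmod // -permX {1}(divn_eq m k) expgD permM.
  congr ((g ^+ (m %% k)) _); elim: (m %/ k) => [|c IHc].
    by rewrite mul0n expg0 perm1.
  by rewrite mulSn expgD permM [(g ^+ k) x]permX iter_porbit.
rewrite !red nth_uniq ?size_traject ?ltn_pmod //.
exact: uniq_traject_porbit.
Qed.

Lemma porbitX_coprime (T : finType) (g : {perm T}) m x :
  coprime m #[g] -> porbit (g ^+ m) x = porbit g x.
Proof.
rewrite coprime_sym -generator_coprime /generator => /eqP E.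
by rewrite porbit.unlock E.
Qed.

Lemma dvdn_card_porbit (T : finType) (g : {perm T}) x : #|porbit g x| %| #[g].
Proof.
have: (g ^+ #[g]) x == (g ^+ 0) x by rewrite expg_order.
by rewrite eq_permX eqn_mod_dvd // subn0.
Qed.

Lemma porbit_morph (T U : finType) (f : T -> U) (s : {perm T}) (t : {perm U}) :
  (forall x, t (f x) = f (s x)) ->
  forall x, porbit t (f x) = f @: porbit s x.
Proof.
move=> tf x; have tfX i : (t ^+ i) (f x) = f ((s ^+ i) x).
  by rewrite !permX; elim: i => //= i ->.
apply/setP=> y; apply/porbitP/imsetP => [[i ->]|[_ /porbitP[i ->] ->]].
  by exists ((s ^+ i) x); rewrite // mem_porbit.
by exists i.
Qed.

(** The sign of the restriction of s to an s-stable set A, with true for -1: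
the parity of #|A| minus the number of its cycles. *)
Definition sign_on (T : finType) (s : {perm T}) (A : {set T}) : bool :=
  odd (#|A| + #|porbit s @: A|).

Lemma sign_onT (T : finType) (s : {perm T}) : sign_on s setT = s.
Proof.
rewrite /sign_on oddD /odd_perm cardsT; congr (_ (+) odd #|pred_of_set _|).
by apply/setP=> O; apply/imsetP/imsetP=> -[x _ ->]; exists x; rewrite ?inE.
Qed.

Lemma sign_on_morph (T U : finType) (f : T -> U) (s : {perm T}) (t : {perm U}) :
    injective f -> (forall x, t (f x) = f (s x)) ->
  sign_on t (f @: setT) = s.
Proof.
move=> injf tf; rewrite -sign_onT /sign_on card_imset // -imset_comp.
congr (odd (_ + _)); rewrite (eq_imset _ (porbit_morph tf)).
by rewrite (imset_comp (fun A : {set T} => f @: A)) card_imset //; apply: imset_inj.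
Qed.

Lemma odd_perm_morph (T U : finType) (f : T -> U) (s : {perm T}) (t : {perm U}) :
    injective f -> #|T| = #|U| -> (forall x, t (f x) = f (s x)) ->
  t = s :> bool.
Proof.
move=> injf ETU tf; rewrite -(sign_on_morph injf tf) -sign_onT; congr sign_on.
by apply/esym/eqP; rewrite eqEcard subsetT card_imset // !cardsT ETU leqnn.
Qed.

(** For a map h that is constant on cycles, each fibre of h is a union of cycles. *)
Lemma sign_on_blocks (T J : finType) (h : T -> J) (s : {perm T}) :
    (forall x, h (s x) = h x) ->
  s = \big[addb/false]_(j : J) sign_on s [set x | h x == j] :> bool.
Proof.
move=> hs; pose B j := [set x | h x == j].
have hX x y : y \in porbit s x -> h y = h x.
  by case/porbitP=> i ->; rewrite permX; elim: i => //= i <-.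
have cardU (V : finType) (F : J -> {set V}) :
    (forall i j, i != j -> [disjoint F i & F j]) ->
  #|\bigcup_j F j| = (\sum_j #|F j|)%N.
  move=> dF; rewrite -sum1_card (partition_disjoint_bigcup _ _ dF).
  by apply: eq_bigr => j _; rewrite sum1_card.
have UB : \bigcup_j B j = setT.
  by apply/setP=> x; rewrite inE; apply/bigcupP; exists (h x); rewrite // inE.
have UP : \bigcup_j (porbit s @: B j) = porbit s @: setT.
  rewrite -UB; apply/setP=> O; apply/bigcupP/imsetP => [[j _ /imsetP[x xB ->]]|].
    by exists x => //; apply/bigcupP; exists j.
  by case=> x /bigcupP[j _ xB] ->; exists j; rewrite // imset_f.
rewrite -[LHS]sign_onT /sign_on -{1}UB -UP !cardU.
- by rewrite -big_split /= (big_morph _ oddD (erefl : odd 0 = false)).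
- move=> i j ij; apply/pred0P=> O /=.
  apply/negP=> /andP[/imsetP[x xi ->] /imsetP[y yj]].
  move/eqP; rewrite eq_porbit_mem => /hX hxy; move: xi yj ij.
  by rewrite !inE hxy => /eqP -> ->.
- move=> i j ij; apply/pred0P=> x /=; rewrite !inE; apply/negP=> /andP[/eqP -> E].
  by rewrite E in ij.
Qed.

(** There are 1 + #|~: A| cycles, while #|T| = #|A| + #|~: A|. *)
Lemma odd_single_cycle (T : finType) (s : {perm T}) (A : {set T}) x :
    x \in A -> A \subset porbit s x -> {in ~: A, forall y, s y = y} ->
  ~~ odd #|A| -> s.
Proof.
move=> xA sA fixA evA; have fixO y : y \in ~: A -> porbit s y = [set y].
  move=> yA; apply/setP=> z; rewrite inE; apply/porbitP/eqP => [[i ->]|->].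
    by rewrite permX; elim: i => //= i ->; apply: fixA.
  by exists 0; rewrite perm1.
rewrite /odd_perm -(cardsC A).
have -> : porbits s = porbit s x |: [set [set y] | y in ~: A].
  apply/setP=> O; apply/imsetP/setU1P => [[y _ ->]|[->|/imsetP[y yA ->]]].
  - have [yA|yA] := boolP (y \in A); [left|right].
      by apply/eqP; rewrite eq_porbit_mem (subsetP sA).
    by rewrite fixO ?inE // imset_f ?inE.
  - by exists x.
  - by exists y; rewrite // fixO.
rewrite cardsU1 card_imset; last exact: set1_inj.
have -> : porbit s x \notin [set [set y] | y in ~: A].
  apply/imsetP=> -[y]; rewrite inE => yA E; case/negP: yA.
  have: x \in [set y] by rewrite -E porbit_id.
  by rewrite inE => /eqP <-.
by rewrite add1n /= oddD (negPf evA) addFb addbN addbb.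
Qed.

Lemma odd_order_even (T : finType) (s : {perm T}) N : odd N -> s ^+ N = 1 -> ~~ s.
Proof.
move=> oN sN1; have: odd_perm (s ^+ N) = false by rewrite sN1 odd_perm1.
have -> : odd_perm (s ^+ N) = odd N && s.
  elim: N {oN sN1} => [|N IHN]; first by rewrite expg0 odd_perm1.
  by rewrite expgS odd_permM IHN /=; case: (odd N); case: (odd_perm s).
by rewrite oN /= => ->.
Qed.

Definition cycle_sizes (T : finType) (g : {perm T}) : seq nat :=
  [seq #|pred_of_set C| | C in porbits g].

Lemma cycle_sizeP (T : finType) (g : {perm T}) k :
  reflect (exists x, k = #|porbit g x|) (k \in cycle_sizes g).
Proof.
apply: (iffP imageP) => [[C /imsetP[x _ ->] ->]|[x ->]]; first by exists x.
by exists (porbit g x); rewrite // imset_f.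
Qed.

Lemma cycle_sizes_morph (T U : finType) (f : T -> U) (s : {perm T}) (t : {perm U}) :
    injective f -> #|T| = #|U| -> (forall x, t (f x) = f (s x)) ->
  perm_eq (cycle_sizes t) (cycle_sizes s).
Proof.
move=> injf ETU tf; have [f' fK f'K] : bijective f by apply: inj_card_bij; rewrite ?ETU.
pose F (C : {set T}) := f @: C.
have E : perm_eq (enum (porbits t)) (map F (enum (porbits s))).
  apply: uniq_perm; first exact: enum_uniq.
    by rewrite map_inj_uniq ?enum_uniq //; apply: imset_inj.
  move=> C; rewrite mem_enum; apply/imsetP/mapP => [[y _ ->]|[D]].
    exists (porbit s (f' y)); first by rewrite mem_enum imset_f.
    by rewrite /F -(porbit_morph tf) f'K.
  rewrite mem_enum => /imsetP[x _ ->] ->; exists (f x) => //.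
  by rewrite /F (porbit_morph tf).
rewrite (perm_trans (perm_map _ E)) // -map_comp.
rewrite (@eq_map _ _ _ (fun C : {set T} => #|C|)) //.
by move=> C; rewrite /= card_imset.
Qed.

End Cycles.

(** * The sign of multiplication by m modulo k *)

Section MulSign.

Local Open Scope nat_scope.

Definition mul_ord k m (x : 'I_k) : 'I_k :=
  Ordinal (ltn_pmod (m * x) (leq_ltn_trans (leq0n x) (ltn_ord x))).

(** The value 1 is a default for an m that is not prime to k. *)
Definition mul_perm k m : {perm 'I_k} :=
  if @idP (injectiveb (@mul_ord k m)) is ReflectT inj
  then perm (injectiveP _ inj) else 1%g.

Lemma mul_ord_inj k m : coprime m k -> injective (@mul_ord k m).
Proof.
move=> co y z /(congr1 val) /= /eqP; apply: contraTeq.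
wlog yz : y z / y < z.
  move=> IH yz; have := yz; rewrite -val_eqE neq_ltn => /orP[/IH|/IH]; first exact.
  by rewrite [z == y]eq_sym [_ %% k == _]eq_sym; apply.
move=> _; rewrite eq_sym eqn_mod_dvd ?leq_mul // 1?ltnW //.
rewrite -mulnBr Gauss_dvdr 1?coprime_sym // gtnNdvd ?subn_gt0 //.
exact: leq_ltn_trans (leq_subr _ _) (ltn_ord z).
Qed.

Lemma mul_permE k m (x : 'I_k) :
  coprime m k -> mul_perm k m x = (m * x) %% k :> nat.
Proof.
move=> co; rewrite /mul_perm; case: {-}_ / idP => [inj|]; first by rewrite permE.
by case; apply/injectiveP/mul_ord_inj.
Qed.

(** For odd k prime to m this is the Jacobi symbol, with true for -1. *)
Definition mul_sign k m : bool := mul_perm k m.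

Lemma mul_sign_mod k m m' :
  coprime m k -> m = m' %[mod k] -> mul_sign k m = mul_sign k m'.
Proof.
move=> co E; have co' : coprime m' k by rewrite -coprime_modl -E coprime_modl.
congr odd_perm; apply/permP=> x; apply/val_inj.
by rewrite /= !mul_permE // -modnMml E modnMml.
Qed.

Lemma mul_sign1 k : mul_sign k 1 = false.
Proof.
have -> : mul_sign k 1 = odd_perm (1 : {perm 'I_k}); last exact: odd_perm1.
congr odd_perm; apply/permP=> x; apply/val_inj.
by rewrite perm1 /= mul_permE ?coprime1n // mul1n modn_small.
Qed.

Lemma big_addb_const n c : \big[addb/false]_(i < n) c = odd n && c.
Proof.
elim: n => [|n IHn]; first by rewrite big_ord0.
by rewrite big_ord_recl {}IHn /=; case: c; case: (odd n).
Qed.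

(** Write elements of Z/ab as r + a s.  Multiplication by m is then the product
map, whose sign is the sign modulo a to the power b times the sign modulo b to
the power a, followed by the translation of s by a carry that depends on r.
The latter has order dividing b, which is odd, so it is an even permutation. *)
Section Product.

Variables (a b m : nat).
Hypotheses (odd_a : odd a) (odd_b : odd b) (coa : coprime m a) (cob : coprime m b).

Let pair_perm1 (x : 'I_a * 'I_b) := (mul_perm a m x.1, x.2).
Let pair_perm2 (x : 'I_a * 'I_b) := (x.1, mul_perm b m x.2).

Let pair_perm1_inj : injective pair_perm1.
Proof. by move=> [x y] [x' y'] [/perm_inj -> ->]. Qed.
Let pair_perm2_inj : injective pair_perm2.
Proof. by move=> [x y] [x' y'] [-> /perm_inj ->]. Qed.

Let sign_pair1 : perm pair_perm1_inj = mul_sign a m :> bool.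
Proof.
rewrite (@sign_on_blocks _ _ snd); last by move=> x; rewrite permE.
rewrite (eq_bigr (fun=> mul_sign a m)) => [|j _].
  by rewrite big_addb_const odd_b.
rewrite /mul_sign -(@sign_on_morph _ _ (fun i => (i, j)) (mul_perm a m)
  (perm pair_perm1_inj)).
- congr sign_on; apply/setP=> [[x y]]; rewrite inE /=.
  by apply/eqP/imsetP => [->|[z _ [_ ->]]] //; exists x; rewrite ?inE.
- by move=> x y [].
- by move=> x; rewrite permE.
Qed.

Let sign_pair2 : perm pair_perm2_inj = mul_sign b m :> bool.
Proof.
rewrite (@sign_on_blocks _ _ fst); last by move=> x; rewrite permE.
rewrite (eq_bigr (fun=> mul_sign b m)) => [|j _].
  by rewrite big_addb_const odd_a.
rewrite /mul_sign -(@sign_on_morph _ _ (fun i => (j, i)) (mul_perm b m)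
  (perm pair_perm2_inj)).
- congr sign_on; apply/setP=> [[x y]]; rewrite inE /=.
  by apply/eqP/imsetP => [->|[z _ [-> _]]] //; exists y; rewrite ?inE.
- by move=> x y [].
- by move=> x; rewrite permE.
Qed.

Let digits_lt (x : 'I_a * 'I_b) : x.1 + a * x.2 < a * b.
Proof.
case: x => [[r ra] [s sb]] /=.
apply: (@leq_trans (a + a * s)); first by rewrite ltn_add2r.
by rewrite -mulnS leq_mul2l sb orbT.
Qed.

Let digits (x : 'I_a * 'I_b) : 'I_(a * b) := Ordinal (digits_lt x).

Let digits_inj : injective digits.
Proof.
move=> [r s] [r' s'] /(congr1 val) /= E.
have a_gt0 : 0 < a := leq_ltn_trans (leq0n r) (ltn_ord r).
have Er : r = r'.
  apply/val_inj; move: (congr1 (modn^~ a) E).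
  by rewrite /= ![_ + a * _]addnC ![a * _]mulnC !modnMDl !modn_small.
move: E; rewrite Er => /eqP; rewrite eqn_add2l eqn_pmul2l // => /eqP E.
by congr (_, _); apply/val_inj.
Qed.

Let carry (r : nat) := (m * r) %/ a.

Let b_gt0 : 0 < b. Proof. by case: (b) odd_b. Qed.

Let pair_mul (x : 'I_a * 'I_b) : 'I_a * 'I_b :=
  (mul_perm a m x.1, Ordinal (ltn_pmod (m * x.2 + carry x.1) b_gt0)).

Let pair_mulE x : digits (pair_mul x) = mul_perm (a * b) m (digits x).
Proof.
have a_gt0 : 0 < a by case: (a) odd_a.
apply/val_inj; rewrite [RHS]mul_permE ?coprimeMr ?coa //.
case: x => r s /=; rewrite mul_permE //.
have -> : m * (r + a * s) = (m * r) %% a + a * (m * s + carry r).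
  rewrite /carry; have := divn_eq (m * r) a; nia.
set u := m * s + carry r.
have := divn_eq u b => Eu.
rewrite {2}Eu.
have -> : (m * r) %% a + a * (u %/ b * b + u %% b)
       = u %/ b * (a * b) + ((m * r) %% a + a * (u %% b)) by nia.
rewrite modnMDl [RHS]modn_small //.
exact: (digits_lt (Ordinal (ltn_pmod (m * r) a_gt0), Ordinal (ltn_pmod u b_gt0))).
Qed.

Let pair_mul_inj : injective pair_mul.
Proof.
move=> x y E; apply/digits_inj/(@perm_inj _ (mul_perm (a * b) m)).
by rewrite -!pair_mulE E.
Qed.

Lemma mul_signM : mul_sign (a * b) m = mul_sign a m (+) mul_sign b m.
Proof.
pose P := (perm pair_perm1_inj * perm pair_perm2_inj)%g.
pose M := perm pair_mul_inj; pose Q := (P^-1 * M)%g.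
have -> : mul_sign (a * b) m = M.
  apply: (odd_perm_morph digits_inj); first by rewrite card_prod !card_ord.
  by move=> x; rewrite permE pair_mulE.
have -> : M = (P * Q)%g by rewrite mulKVg.
rewrite odd_permM [odd_perm P]odd_permM sign_pair1 sign_pair2.
suff /negPf-> : ~~ odd_perm Q by rewrite addbF.
apply: (odd_order_even odd_b).
(* Q is the carry, expressed at the already multiplied digit r. *)
pose c (r : 'I_a) := carry ((mul_perm a m)^-1%g r).
have QE x : (Q x).1 = x.1 /\ (Q x).2 = (x.2 + c x.1) %% b :> nat.
  rewrite -[x](permKV P); move: (P^-1%g x) => {x} [r s].
  have -> : Q (P (r, s)) = pair_mul (r, s) by rewrite permM permK permE.
  have -> : P (r, s) = (mul_perm a m r, mul_perm b m s) by rewrite permM !permE.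
  split=> //=.
  by rewrite /c permK mul_permE // modnDml.
have QX j x : ((Q ^+ j)%g x).1 = x.1 /\ ((Q ^+ j)%g x).2 = (x.2 + j * c x.1) %% b :> nat.
  elim: j => [|j [IH1 IH2]]; first by rewrite expg0 perm1 mul0n addn0 modn_small.
  rewrite expgSr permM; have [-> ->] := QE ((Q ^+ j)%g x).
  by rewrite IH1 IH2 modnDml -addnA -mulSnr.
apply/permP=> x; rewrite perm1; have [E1 E2] := QX b x.
rewrite [LHS]surjective_pairing [RHS]surjective_pairing E1; congr (_, _).
by apply/val_inj; rewrite /= E2 addnC mulnC modnMDl modn_small.
Qed.

End Product.

Lemma mul_sign_sqr d m : odd d -> coprime m d -> mul_sign (d ^ 2) m = false.
Proof. by move=> od co; rewrite expnS expn1 mul_signM // addbb. Qed.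

Lemma mul_signX p e m :
  odd p -> coprime m p -> mul_sign (p ^ e) m = odd e && mul_sign p m.
Proof.
move=> op co; elim: e => [|e IHe].
  rewrite expn0 /= -(@mul_sign_mod 1 1) ?coprimen1 ?mul_sign1 //.
  by rewrite !modn1.
rewrite expnS mul_signM ?oddX ?op ?orbT ?coprimeXr // IHe /=.
by case: (odd e); case: (mul_sign p m).
Qed.

(** The unit group of 'F_p is cyclic. *)
Lemma primitive_root_exists p : prime p ->
  exists2 u, coprime u p & forall x, ~~ (p %| x) -> exists i, u ^ i = x %[mod p].
Proof.
move=> p_pr; have /cyclicP[z Ez] := field_unit_group_cyclic [set: {unit 'F_p}].
have [u Eu] : exists u : nat, (u%:R)%R = val z :> 'F_p.
  by exists (val z : nat); rewrite natr_Zp.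
have natF0 x : ((x%:R)%R == 0 :> 'F_p)%R = (p %| x).
  by rewrite -val_eqE /= val_Fp_nat // /dvdn.
exists u.
  rewrite coprime_sym prime_coprime // -natF0 Eu -GRing.unitfE.
  exact: (valP z).
move=> x; rewrite -natF0 -GRing.unitfE => Ux.
pose y : {unit 'F_p} := FinRing.unit 'F_p Ux.
have: y \in <[z]>%g by rewrite -Ez inE.
case/cycleP=> i Ei; exists i.
have: val y = (val z ^+ i)%R by rewrite Ei FinRing.val_unitX.
rewrite /= -Eu -GRing.natrX => /(congr1 (fun t : 'F_p => t : nat)).
by rewrite !val_Fp_nat // => <-.
Qed.

(** A primitive root permutes the p - 1 nonzero residues in one cycle, of even
length. *)
Lemma mul_sign_prime p : prime p -> odd p -> exists2 u, coprime u p & mul_sign p u.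
Proof.
move=> p_pr op; have [p_gt1 p_gt0] := (prime_gt1 p_pr, prime_gt0 p_pr).
have [u cou gen] := primitive_root_exists p_pr; exists u => //.
pose o0 : 'I_p := Ordinal p_gt0; pose o1 : 'I_p := Ordinal p_gt1.
have orb i : ((mul_perm p u ^+ i)%g o1 : nat) = u ^ i %% p.
  elim: i => [|i IHi]; first by rewrite expg0 perm1 expn0 modn_small.
  by rewrite expgSr permM mul_permE // IHi modnMmr expnS.
apply: (@odd_single_cycle _ _ (~: [set o0]) o1); first by rewrite !inE -val_eqE.
- apply/subsetP=> x; rewrite !inE -val_eqE /= => x0.
  have [|i Ei] := gen x.
    by rewrite gtnNdvd ?lt0n ?(ltn_ord x).
  apply/porbitP; exists i; apply/val_inj; rewrite /= orb Ei modn_small //.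
- move=> x; rewrite !inE negbK => /eqP ->; apply/val_inj.
  by rewrite /= mul_permE //= muln0 mod0n.
by rewrite cardsC1 card_ord -subn1 oddB ?op // ltnW.
Qed.

Lemma odd_logn_nonsquare N : 0 < N -> ~~ is_square N ->
  exists2 p, p \in primes N & odd (logn p N).
Proof.
move=> N_gt0 nsq; apply/hasP; apply: contraNT nsq => /hasPn ev.
apply/is_squareP; exists (\prod_(p <- primes N) p ^ (logn p N)./2).
rewrite [LHS]prod_prime_decomp // prime_decompE big_map /= expnS expn1 -big_split /=.
apply: eq_big_seq => p /ev /negPf evp.
by rewrite -expnD addnn -[in LHS](odd_double_half (logn p N)) evp.
Qed.

(** With p dividing N to an odd power, take m a primitive root modulo p and 1
modulo the part of N prime to p. *)
Lemma mul_sign_nonsquare N : odd N -> ~~ is_square N ->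
  exists2 m, coprime m N & mul_sign N m.
Proof.
move=> oN nsq; have N_gt0 : 0 < N by case: (N) oN.
have [p pN olog] := odd_logn_nonsquare N_gt0 nsq.
have p_pr : prime p by move: pN; rewrite mem_primes => /andP[].
have [N' copN EN] := pfactor_coprime p_pr N_gt0.
have op : odd p by move: oN; rewrite EN oddM oddX => /andP[_]; case: (logn _ _) olog.
have oN' : odd N' by move: oN; rewrite EN oddM => /andP[].
have [u cou sgu] := mul_sign_prime p_pr op.
pose m := chinese p N' u 1.
have Em1 : m = u %[mod p] by apply: chinese_modl.
have Em2 : m = 1 %[mod N'] by apply: chinese_modr.
have com : coprime m p by rewrite -coprime_modl Em1 coprime_modl.
have com' : coprime m N' by rewrite -coprime_modl Em2 coprime_modl coprime1n.
exists m; first by rewrite EN coprimeMr com' coprimeXr.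
rewrite EN mul_signM ?oddX ?op ?orbT ?coprimeXr // mul_signX // olog.
by rewrite (mul_sign_mod com' Em2) mul_sign1 (mul_sign_mod com Em1) sgu.
Qed.

Lemma mul_sign_prod (I : Type) (r : seq I) (P : pred I) (F : I -> nat) m :
    (forall i, P i -> odd (F i) && coprime m (F i)) ->
  mul_sign (\prod_(i <- r | P i) F i) m
    = \big[addb/false]_(i <- r | P i) mul_sign (F i) m.
Proof.
move=> H; suff []: [/\ odd (\prod_(i <- r | P i) F i),
    coprime m (\prod_(i <- r | P i) F i)
  & mul_sign (\prod_(i <- r | P i) F i) m
    = \big[addb/false]_(i <- r | P i) mul_sign (F i) m] by [].
apply: (big_rec2 (fun N s => [/\ odd N, coprime m N & mul_sign N m = s])).
  by rewrite coprimen1; split=> //; apply: (@mul_signX 1 0); rewrite ?coprimen1.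
move=> i N s /H/andP[oF cF] [oN cN <-].
by rewrite oddM oF oN coprimeMr cF cN mul_signM.
Qed.

End MulSign.

(** * Conjugating permutations *)

Section Conjugation.

Local Open Scope group_scope.

Variable T : finType.
Implicit Types g h s : {perm T}.

(** The function r chooses one point in each cycle of g. *)
Definition cycle_reps g (r : T -> T) :=
  (forall x, r x \in porbit g x) /\ (forall x y, y \in porbit g x -> r y = r x).

Lemma cycle_reps_exist g : exists r, cycle_reps g r.
Proof.
exists (fun x => odflt x [pick y in porbit g x]); split=> [x|x y].
  by case: pickP => [y //|/(_ x)]; rewrite porbit_id.
rewrite -eq_porbit_mem => /eqP ->; case: pickP => [z //|/(_ x)].
by rewrite porbit_id.
Qed.

Lemma cycle_rep_power g r x : cycle_reps g r -> exists i, x = (g ^+ i) (r x).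
Proof. by case=> /(_ x) rx _; apply/porbitP; rewrite porbit_sym. Qed.

(** A matching t of cycles of g with cycles of h of the same size, given on the
chosen points, extends along the cycles by g^i (r x) |-> h^i (t (r x)). *)
Lemma conj_from_reps g h r t :
    cycle_reps g r ->
    (forall x, #|porbit h (t (r x))| = #|porbit g x|) ->
    (forall x y, t (r y) \in porbit h (t (r x)) -> y \in porbit g x) ->
  exists2 s, g ^ s = h & forall i x, s ((g ^+ i) (r x)) = (h ^+ i) (t (r x)).
Proof.
move=> rP size_t inj_t; have [r_in r_eq] := rP.
have exi x : exists i, x == (g ^+ i) (r x)
  by have [i Ei] := cycle_rep_power x rP; exists i; rewrite -Ei.
pose ind x := xchoose (exi x).
have indE x : (g ^+ ind x) (r x) = x by rewrite -(eqP (xchooseP (exi x))).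
have r_orb x : porbit g (r x) = porbit g x by apply/eqP; rewrite eq_porbit_mem.
pose f x := (h ^+ ind x) (t (r x)).
have fE i x : f ((g ^+ i) (r x)) = (h ^+ i) (t (r x)).
  rewrite /f; set y := (g ^+ i) (r x).
  have ry : r y = r x by apply: r_eq; rewrite -r_orb mem_porbit.
  rewrite ry; apply/eqP; rewrite eq_permX size_t -r_orb -eq_permX.
  by rewrite -[in X in _ == X]/y -{1}ry indE.
have f_inj : injective f.
  move=> x y fxy.
  have rxy : r x = r y.
    apply/esym/r_eq/inj_t; rewrite -eq_porbit_mem -(porbit_perm h (ind x) (t (r x))).
    by rewrite -/(f x) fxy porbit_perm.
  rewrite -(indE x) -(indE y) -rxy; apply/eqP.
  rewrite eq_permX r_orb -(size_t x) -eq_permX.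
  by rewrite {2}rxy -/(f x) -/(f y) fxy.
exists (perm f_inj); last by move=> i x; rewrite permE.
apply/permP=> u; rewrite -[u](permKV (perm f_inj)).
move: ((perm f_inj)^-1 u) => {}u; rewrite permJ !permE.
by rewrite -{1}(indE u) -permM -expgSr fE expgSr permM.
Qed.

(** A coprime power of g has the same orbits as g, so the chosen points can be
matched with themselves. *)
Lemma conj_coprime_power g m r : cycle_reps g r -> coprime m #[g] ->
  exists2 s, g ^ s = g ^+ m & forall i x, s ((g ^+ i) (r x)) = (g ^+ (m * i)) (r x).
Proof.
move=> rP co; have [r_in r_eq] := rP.
have r_orb x : porbit g (r x) = porbit g x by apply/eqP; rewrite eq_porbit_mem.
have [x|x y|s sg sr] := @conj_from_reps g (g ^+ m) r id rP.
- by rewrite porbitX_coprime // r_orb.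
- by rewrite porbitX_coprime // -eq_porbit_mem !r_orb eq_porbit_mem.
by exists s => // i x; rewrite sr expgM.
Qed.

Lemma sign_on0 s : sign_on s set0 = false.
Proof. by rewrite /sign_on imset0 !cards0. Qed.

Lemma prod_cycle_sizes g : (\prod_(k <- cycle_sizes g) k = \prod_(O in porbits g) #|O|)%N.
Proof. by rewrite big_map big_enum. Qed.

Lemma dvdn_prod_cycle_sizes g x : #|porbit g x| %| \prod_(k <- cycle_sizes g) k.
Proof.
have xin : #|porbit g x| \in cycle_sizes g by apply/cycle_sizeP; exists x.
by rewrite (big_rem _ xin) /= dvdn_mulr.
Qed.

Lemma coprime_prod_cycle_sizes g m :
  coprime m (\prod_(k <- cycle_sizes g) k) = coprime m #[g].
Proof.
apply/idP/idP => co.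
  apply: coprime_dvdr co; rewrite order_dvdn; apply/eqP/permP=> x.
  rewrite perm1 -[RHS](perm1 x) -(expg0 g); apply/eqP.
  by rewrite eq_permX mod0n; apply: dvdn_prod_cycle_sizes.
rewrite big_seq; apply: (big_ind (fun N => coprime m N)); first exact: coprimen1.
  by move=> k l ck cl; rewrite coprimeMr ck.
by move=> _ /cycle_sizeP[x ->]; apply: coprime_dvdr co; apply: dvdn_card_porbit.
Qed.

Lemma odd_prod_cycle_sizes g :
  all odd (cycle_sizes g) -> odd (\prod_(k <- cycle_sizes g) k).
Proof.
by move=> /allP og; rewrite big_seq; elim/big_rec: _ => // k N /og; rewrite oddM => ->.
Qed.

(** Along the cycle of x, the conjugating map is i |-> m i on exponents
modulo #|porbit g x|. *)
Lemma conj_power_sign g m :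
    all odd (cycle_sizes g) -> coprime m #[g] ->
  exists2 s, g ^ s = g ^+ m
    & odd_perm s = mul_sign (\prod_(k <- cycle_sizes g) k) m.
Proof.
move=> /allP odd_g co; have [r rP] := cycle_reps_exist g.
have [s sg sr] := conj_coprime_power rP co; exists s => //.
have [r_in r_eq] := rP.
rewrite prod_cycle_sizes mul_sign_prod; last first.
  move=> _ /imsetP[x _ ->]; rewrite odd_g; last by apply/cycle_sizeP; exists x.
  by apply: coprime_dvdr co; apply: dvdn_card_porbit.
have hs x : porbit g (s x) = porbit g x.
  have [i {1}->] := cycle_rep_power x rP.
  by rewrite sr porbit_perm; apply/eqP; rewrite eq_porbit_mem.
rewrite (sign_on_blocks hs) [RHS]big_mkcond /=; apply: eq_bigr => O _.
case: ifPn => [/imsetP[x _ ->]|nO]; last first.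
  rewrite -[RHS](sign_on0 s); congr sign_on; apply/setP=> x; rewrite !inE.
  by apply: contraNF nO => /eqP <-; apply: imset_f.
have r_orb y : porbit g (r y) = porbit g y by apply/eqP; rewrite eq_porbit_mem.
set k := #|porbit g x|; pose f (i : 'I_k) := (g ^+ i) (r x).
rewrite /mul_sign -(@sign_on_morph _ _ f (mul_perm k m) s).
- congr sign_on; apply/setP=> y; rewrite inE; apply/eqP/imsetP => [E|[i _ ->]].
    have [i Ei] := cycle_rep_power y rP.
    have k_gt0 : (0 < k)%N by rewrite lt0n card_porbit_neq0.
    exists (Ordinal (ltn_pmod i k_gt0)) => //.
    rewrite {1}Ei (r_eq x y) -?E ?porbit_id // /f /=; apply/eqP.
    by rewrite eq_permX r_orb modn_mod.
  by rewrite /f porbit_perm.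
- move=> i j /eqP; rewrite eq_permX r_orb -/k !modn_small // => /eqP.
  exact: val_inj.
move=> i; rewrite /f sr; apply/eqP; rewrite eq_permX r_orb.
rewrite mul_permE ?modn_mod //.
by apply: coprime_dvdr co; apply: dvdn_card_porbit.
Qed.

(** The restriction of g to its even cycle. *)
Lemma odd_centraliser_even_cycle g x : ~~ odd #|porbit g x| ->
  exists2 z : {perm T}, g ^ z = g & z.
Proof.
move=> evx; have [r rP] := cycle_reps_exist g; have [r_in r_eq] := rP.
have r_orb y : porbit g (r y) = porbit g y by apply/eqP; rewrite eq_porbit_mem.
pose t u := if u \in porbit g x then g u else u.
have t_orb u : porbit g (t u) = porbit g u.
  by rewrite /t; case: ifP => // _; rewrite (porbit_perm g 1).
have [y|y y'|z zg zr] := @conj_from_reps g g r t rP.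
- by rewrite t_orb r_orb.
- by rewrite -eq_porbit_mem !t_orb !r_orb eq_porbit_mem.
exists z => //; have zE u : z u = if u \in porbit g x then g u else u.
  have [i Eu] := cycle_rep_power u rP; rewrite {1}Eu zr /t.
  rewrite -eq_porbit_mem r_orb eq_porbit_mem; case: ifP => _ //.
  by rewrite -permM -expgS expgSr permM -Eu.
apply: (@odd_single_cycle _ _ (porbit g x) x) => //; first exact: porbit_id.
  apply/subsetP=> u /porbitP[i ->]; apply/porbitP; exists i.
  elim: i => [|i IHi]; first by rewrite !expg0.
  by rewrite !expgSr !permM -IHi zE mem_porbit.
by move=> y; rewrite inE zE => /negPf ->.
Qed.

(** A square root of g on two cycles of size k: it goes from each of them to
the other and joins them in one cycle of length 2k. *)
Lemma odd_centraliser_equal_cycles g a b :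
    #|porbit g a| = #|porbit g b| -> b \notin porbit g a ->
  exists2 z : {perm T}, g ^ z = g & z.
Proof.
have [r rP] := cycle_reps_exist g; have [r_in r_eq] := rP.
have r_orb y : porbit g (r y) = porbit g y by apply/eqP; rewrite eq_porbit_mem.
have r_id y : r (r y) = r y by apply: r_eq.
rewrite -eq_porbit_mem -(r_orb a) -(r_orb b).
move: (r a) (r b) (r_id a) (r_id b) => {}a {}b ra rb Eab nab.
pose t u := if u == a then b else if u == b then g a else u.
have t_orb u : porbit g (t u) =
    if u == a then porbit g b else if u == b then porbit g a else porbit g u.
  by rewrite /t; do 2![case: ifP => // _]; rewrite (porbit_perm g 1).
have rorb_eq u v : (porbit g (r u) == porbit g (r v)) = (r u == r v).
  apply/eqP/eqP => [E|-> //]; rewrite -r_id -[RHS]r_id.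
  by apply: r_eq; rewrite -E porbit_id.
have [y|y y'|z zg zr] := @conj_from_reps g g r t rP.
- rewrite t_orb -(r_orb y); case: eqP => [-> //|_]; case: eqP => [-> //|_] //.
- rewrite -eq_porbit_mem !t_orb -eq_porbit_mem -(r_orb y) -(r_orb y').
  have na u : porbit g (r u) == porbit g a = (r u == a) by rewrite -{1}ra rorb_eq ra.
  have nb u : porbit g (r u) == porbit g b = (r u == b) by rewrite -{1}rb rorb_eq rb.
  case: (altP (r y' =P a)) => [->|y'a]; case: (altP (r y =P a)) => [->|ya] //.
  - by case: ifP => [_|/negP yb]; rewrite ?(negPf nab) // (eq_sym (porbit g b)) nb => /yb.
  - by case: ifP => [_|/negP yb]; [rewrite eq_sym (negPf nab) | rewrite nb => /yb].
  case: (altP (r y' =P b)) => [->|y'b]; case: (altP (r y =P b)) => [->|yb] //.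
  - by rewrite eq_sym na (negPf ya).
  - by rewrite na (negPf y'a).
exists z => //.
have zgX i u : z ((g ^+ i) u) = (g ^+ i) (z u) by rewrite -{2}zg -conjXg permJ.
have ba : b != a by apply: contraNneq nab => ->.
have za : z a = b by have := zr 0 a; rewrite !expg0 !perm1 ra /t eqxx.
have zb : z b = g a by have := zr 0 b; rewrite !expg0 !perm1 rb /t (negPf ba) eqxx.
have zz i : (z ^+ (i * 2)) a = (g ^+ i) a.
  elim: i => [|i IHi]; first by rewrite !expg0.
  by rewrite mulSn addnC expgD permM IHi expgS permM expg1 !zgX za zb -permM -expgS.
apply: (@odd_single_cycle _ _ (porbit g a :|: porbit g b) a).
- by rewrite inE porbit_id.
- apply/subsetP=> u /setUP[] /porbitP[i ->]; apply/porbitP.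
    by exists (i * 2)%N.
  by exists (i * 2).+1; rewrite expgSr permM zz zgX za.
- move=> y; rewrite !inE negb_or => /andP[ya yb].
  have [i Ey] := cycle_rep_power y rP; rewrite {1}Ey zr {2}Ey /t.
  rewrite ifN; last by apply: contraNneq ya => <-; rewrite -eq_porbit_mem r_orb.
  by rewrite ifN //; apply: contraNneq yb => <-; rewrite -eq_porbit_mem r_orb.
rewrite cardsU disjoint_setI0; first by rewrite cards0 subn0 -Eab addnn odd_double.
apply/pred0P=> y /=; apply: contraNF nab => /andP[].
by rewrite -!eq_porbit_mem => /eqP <- /eqP ->.
Qed.

Lemma cycle_sizes_inj g x y : uniq (cycle_sizes g) ->
  #|porbit g x| = #|porbit g y| -> porbit g x = porbit g y.
Proof. by move/dinjectiveP; apply; apply: imset_f. Qed.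

(** As the sizes are distinct, z preserves each cycle, on which it is a power
of g.  So z to the product of the sizes, which is odd, is 1. *)
Lemma centraliser_even g z :
    uniq (cycle_sizes g) -> all odd (cycle_sizes g) -> g ^ z = g -> ~~ odd_perm z.
Proof.
move=> ug og zg; apply: (odd_order_even (odd_prod_cycle_sizes og)).
have zgX i u : z ((g ^+ i) u) = (g ^+ i) (z u) by rewrite -{2}zg -conjXg permJ.
apply/permP=> u; rewrite perm1.
have zu : z u \in porbit g u.
  rewrite -eq_porbit_mem; apply/eqP/cycle_sizes_inj => //.
  have -> : porbit g (z u) = z @: porbit g u.
    by apply: porbit_morph => x; have := zgX 1%N x; rewrite expg1.
  by rewrite card_imset //; apply: perm_inj.
have /porbitP[j Ej] := zu.
have zX i : (z ^+ i) u = (g ^+ (j * i)) u.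
  elim: i => [|i IHi]; first by rewrite muln0 !expg0.
  by rewrite expgSr permM IHi zgX Ej -permM -expgD mulnS.
rewrite zX -[RHS](perm1 u) -(expg0 g); apply/eqP; rewrite eq_permX mod0n.
by apply: dvdn_mull; apply: dvdn_prod_cycle_sizes.
Qed.

Lemma conj_same_sizes g h : perm_eq (cycle_sizes g) (cycle_sizes h) ->
  uniq (cycle_sizes g) -> exists s, g ^ s = h.
Proof.
move=> E ug; have [r rP] := cycle_reps_exist g; have [r_in r_eq] := rP.
have r_orb y : porbit g (r y) = porbit g y by apply/eqP; rewrite eq_porbit_mem.
pose t x := odflt x [pick y | #|porbit h y| == #|porbit g x|].
have tE x : #|porbit h (t x)| = #|porbit g x|.
  rewrite /t; case: pickP => [y /eqP //|no].
  have: #|porbit g x| \in cycle_sizes h.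
    by rewrite -(perm_mem E); apply/cycle_sizeP; exists x.
  by case/cycle_sizeP=> y Ey; have := no y; rewrite -Ey eqxx.
have [x|x y|s sg _] := @conj_from_reps g h r t rP; last by exists s.
  by rewrite tE r_orb.
rewrite -!eq_porbit_mem => /eqP E'; apply/eqP/cycle_sizes_inj => //.
by rewrite -(r_orb x) -(r_orb y) -!tE E'.
Qed.

(** An odd z commuting with g, multiplied with a conjugation of g to g ^+ m,
gives a second one of the other sign: g is then rational. *)
Lemma irrational_AltP g :
  reflect [/\ uniq (cycle_sizes g), all odd (cycle_sizes g)
            & ~~ is_square (\prod_(k <- cycle_sizes g) k)]
          (g \in irrational_elts 'Alt_T).
Proof.
have fuse z m : odd_perm z -> g ^ z = g -> coprime m #[g] -> g ^+ m \in g ^: 'Alt_T.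
  move=> oz zg co; have [r rP] := cycle_reps_exist g.
  have [s sg _] := conj_coprime_power rP co; rewrite -sg.
  have [os|es] := boolP (odd_perm s); last by rewrite imset_f // Alt_even.
  by apply/imsetP; exists (z * s); rewrite ?Alt_even ?odd_permM ?oz ?os // conjgM zg.
apply: (iffP (irrationalP _ _)) => [[gA [m co gm]]|[ug og nsq]].
  have ug : uniq (cycle_sizes g).
    apply: contraR gm => /dinjectivePn[C /imsetP[x _ ->] [D]].
    rewrite !inE => /andP[yx /imsetP[y _ E]]; move: yx; rewrite {}E.
    rewrite eq_porbit_mem => yx Exy.
    by have [z zg oz] := odd_centraliser_equal_cycles Exy yx; apply: fuse zg co.
  have og : all odd (cycle_sizes g).
    apply: contraR gm => /allPn[_ /cycle_sizeP[x ->]] evx.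
    by have [z zg oz] := odd_centraliser_even_cycle evx; apply: fuse zg co.
  split=> //; apply: contra gm => /is_squareP[d Ed].
  have [s <- os] := conj_power_sign og co; rewrite imset_f // Alt_even os Ed.
  have od : odd d by have := odd_prod_cycle_sizes og; rewrite Ed oddX.
  rewrite mul_sign_sqr //.
  by move: co; rewrite -coprime_prod_cycle_sizes Ed coprime_pexpr.
split; first by rewrite Alt_even; apply: (centraliser_even ug og); rewrite conjgE mulKg.
have [m co sgm] := mul_sign_nonsquare (odd_prod_cycle_sizes og) nsq.
have co' : coprime m #[g] by rewrite -coprime_prod_cycle_sizes.
exists m => //; have [s sg os] := conj_power_sign og co'.
apply/imsetP=> -[a]; rewrite Alt_even => ea ga.
have: ~~ odd_perm (s * a^-1).
  by apply: (centraliser_even ug og); rewrite conjgM sg ga conjgK.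
by rewrite odd_permM odd_permV os sgm (negPf ea).
Qed.

End Conjugation.

(** * Counting by cycle type *)

Section Realisation.

Variable s : seq nat.
Hypothesis s_pos : 0 \notin s.

Let part (i : 'I_(size s)) := 'I_(nth 0 s i).

Let point := {i : 'I_(size s) & part i}.

Let rotate (x : point) : point := Tagged part (ordS (tagged x)).

Let rotate_inj : injective rotate.
Proof.
apply: (can_inj (g := fun x => Tagged part (ord_pred (tagged x)))).
by case=> i j; rewrite /rotate /= ordSK.
Qed.

Let c : {perm point} := perm rotate_inj.

Let cX k i (j : part i) :
  (c ^+ k)%g (Tagged part j)
   = Tagged part (iter k (@ordS _) j).
Proof.
by rewrite permX; elim: k => //= k ->; rewrite permE.
Qed.

Let val_iter_ordS k n (j : 'I_n) : iter k (@ordS n) j = (j + k) %% n :> nat.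
Proof.
elim: k => [|k IHk]; first by rewrite addn0 modn_small.
by rewrite /= IHk -addn1 modnDml addn1 addnS.
Qed.

Let fibre i : {set point} := [set x | tag x == i].

Let porbit_fibre x : porbit c x = fibre (tag x).
Proof.
case: x => i j; apply/setP=> -[i' j']; rewrite inE /=.
apply/porbitP/eqP => [[k]|E]; first by rewrite cX => /(congr1 tag).
case: _ / (esym E) j' => j'; exists (j' + (nth 0 s i - j)).
rewrite cX; congr (Tagged _ _); apply/val_inj.
by rewrite /= val_iter_ordS addnCA subnKC ?modnDr ?modn_small // ltnW.
Qed.

Let card_fibre i : #|fibre i| = nth 0 s i.
Proof.
have -> : fibre i = (fun j : part i => Tagged part j) @: setT.
  apply/setP=> -[i' j']; rewrite inE /=; apply/eqP/imsetP => [E|[j _ /(congr1 tag)] //].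
  by case: _ / (esym E) j' => j'; exists j'.
rewrite card_imset ?cardsT ?card_ord // => j j' /eqP.
by rewrite eq_Tagged => /eqP.
Qed.

Let ord_nth : [seq nth 0 s (val i) | i <- enum 'I_(size s)] = s.
Proof. by rewrite (map_comp (nth 0 s) val) val_enum_ord -/(mkseq _ _) mkseq_nth. Qed.

Let cycle_sizes_c : perm_eq (cycle_sizes c) s.
Proof.
have E : perm_eq (enum (porbits c)) [seq fibre i | i <- enum 'I_(size s)].
  have fibre_pos (i : 'I_(size s)) : 0 < nth 0 s i.
    by rewrite lt0n; apply: contraNneq s_pos => <-; apply: mem_nth.
  have fibreP i : exists2 x, x \in fibre i & tag x = i.
    by exists (Tagged part (Ordinal (fibre_pos i))); rewrite ?inE.
  apply: uniq_perm; first exact: enum_uniq.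
    rewrite map_inj_uniq ?enum_uniq // => i j Eij.
    by have [x] := fibreP i; rewrite Eij inE => /eqP <- <-.
  move=> C; rewrite mem_enum; apply/imsetP/mapP => [[x _ ->]|[i _ ->]].
    by exists (tag x); rewrite ?mem_enum ?porbit_fibre.
  by have [x _ <-] := fibreP i; exists x; rewrite ?porbit_fibre.
rewrite (perm_trans (perm_map _ E)) // -map_comp.
by rewrite (eq_map card_fibre) ord_nth.
Qed.

(** Rotate each summand of the disjoint union of the 'I_k, for k in s, and
transport the result to 'I_n. *)
Lemma perm_of_cycle_sizes n : sumn s = n ->
  exists g : {perm 'I_n}, perm_eq (cycle_sizes g) s.
Proof.
move=> sum_s; have cardP : #|{: point}| = n.
  rewrite card_tagged -sum_s; congr sumn; rewrite -[RHS]ord_nth.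
  by apply: eq_map => i; rewrite card_ord.
pose f (x : point) : 'I_n := cast_ord cardP (enum_rank x).
pose f' (y : 'I_n) : point := enum_val (cast_ord (esym cardP) y).
have fK : cancel f f' by move=> x; rewrite /f' /f cast_ordK enum_rankK.
have f'K : cancel f' f by move=> x; rewrite /f' /f enum_valK cast_ordKV.
have inj : injective (f \o c \o f').
  apply: inj_comp (can_inj f'K); apply: inj_comp perm_inj; exact: can_inj fK.
exists (perm inj); apply: perm_trans cycle_sizes_c.
apply: (cycle_sizes_morph (can_inj fK)); first by rewrite cardP card_ord.
by move=> x; rewrite permE /= fK.
Qed.

End Realisation.

Lemma cycle_sizesJ (T : finType) (g s : {perm T}) :
  perm_eq (cycle_sizes (g ^ s)%g) (cycle_sizes g).
Proof. by apply: (cycle_sizes_morph (@perm_inj _ s)) => // x; rewrite permJ. Qed.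

Lemma sum_cycle_sizes (T : finType) (g : {perm T}) : sumn (cycle_sizes g) = #|T|.
Proof.
rewrite sumnE big_map big_enum -cardsT; apply/esym/card_partition/and3P; split.
- rewrite eqEsubset subsetT; apply/subsetP=> x _; apply/bigcupP.
  by exists (porbit g x); rewrite ?imset_f ?porbit_id.
- apply/trivIsetP=> _ _ /imsetP[x _ ->] /imsetP[y _ ->] nxy.
  apply/pred0P=> z /=; apply: contraNF nxy => /andP[].
  by rewrite -!eq_porbit_mem => /eqP <- /eqP ->.
by apply/imsetP=> -[x _ E]; have := porbit_id g x; rewrite -E inE.
Qed.

Lemma cycle_sizes_pos (T : finType) (g : {perm T}) : 0 \notin cycle_sizes g.
Proof.
by apply/negP=> /cycle_sizeP[x E]; have := card_porbit_neq0 g x; rewrite -E.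
Qed.

Section Count.

Variable n : nat.

Let nonsquare : {set n.-bseq 'I_n.+1} :=
  [set p in distinct_odd_partitions n | ~~ is_square (\prod_(k <- bseq_parts p) k)].

Lemma delta_nonsquare : delta n + #|nonsquare| = q n.
Proof.
rewrite -[RHS](cardsID [set p | is_square (\prod_(k <- bseq_parts p) k)]).
congr (_ + _); apply: eq_card => p; rewrite !inE //.
by rewrite andbC.
Qed.

Let of_type (p : n.-bseq 'I_n.+1) : {set {perm 'I_n}} :=
  [set g | perm_eq (cycle_sizes g) (bseq_parts p)].

Let of_typeE p : p \in nonsquare -> exists2 g : {perm 'I_n},
  g \in irrational_elts 'Alt_('I_n) & of_type p = (g ^: 'Sym_('I_n))%g.
Proof.
rewrite !inE => /andP[/and3P[/and3P[_ p0 /eqP psum] up op] nsq].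
have [g Eg] := perm_of_cycle_sizes p0 psum.
have ug : uniq (cycle_sizes g) by rewrite (perm_uniq Eg).
exists g; first by apply/irrational_AltP; rewrite (perm_all _ Eg) (perm_big _ Eg).
apply/setP=> h; rewrite inE; apply/idP/imsetP => [Eh|[x _ ->]].
  have [|x <-] := @conj_same_sizes _ g h _ ug; last by exists x; rewrite ?inE.
  by rewrite (perm_trans Eg) // perm_sym.
exact: perm_trans (cycle_sizesJ g x) Eg.
Qed.

(** The map that sends a partition to the set of permutations of that cycle
type is the bijection. *)
Lemma card_irrational_Sym_classes :
  #|[set (g ^: 'Sym_('I_n))%g | g in irrational_elts 'Alt_('I_n)]| = #|nonsquare|.
Proof.
have <- : of_type @: nonsquare
    = [set (g ^: 'Sym_('I_n))%g | g in irrational_elts 'Alt_('I_n)].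
  apply/setP=> C; apply/imsetP/imsetP => [[p /of_typeE[g gN Ep] ->]|[g gN ->]].
    by exists g.
  have /irrational_AltP[ug og nsq] := gN.
  have Es : perm_eq (sort geq (cycle_sizes g)) (cycle_sizes g) by rewrite perm_sort.
  have part_g : is_partition n (sort geq (cycle_sizes g)).
    rewrite /is_partition (perm_mem Es) cycle_sizes_pos (perm_sumn Es).
    by rewrite sum_cycle_sizes card_ord eqxx sort_sorted.
  have [p Ep] := partition_bseq part_g.
  have pN : p \in nonsquare.
    by rewrite !inE Ep part_g (perm_uniq Es) (perm_all _ Es) (perm_big _ Es) ug og nsq.
  have [h hN Eh] := of_typeE pN; exists p; first exact: pN.
  have: g \in of_type p by rewrite inE Ep perm_sym.
  by rewrite Eh => /class_eqP.
rewrite card_in_imset // => p p' pN p'N E.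
have [g _ Eg] := of_typeE pN.
have g1 : g \in of_type p by rewrite Eg class_refl.
have g2 : g \in of_type p' by rewrite -E.
apply: bseq_parts_inj; move: pN p'N g1 g2; rewrite !inE.
move=> /andP[/and3P[/and3P[sp _ _] _ _] _] /andP[/and3P[/and3P[sp' _ _] _ _] _] g1 g2.
apply: (sorted_eq (leT := geq)) => //.
- by move=> x y z xy yx; apply: leq_trans yx xy.
- by move=> x y; rewrite andbC => /anti_leq.
by rewrite -(permPl g1).
Qed.

End Count.

(** * The count for the alternating group *)

Lemma alt_power_conj (T : finType) (g : {perm T}) m :
  coprime m #[g]%g -> (g ^+ m \in g ^: 'Sym_T)%g.
Proof.
move=> co; have [r rP] := cycle_reps_exist g.
have [s <- _] := conj_coprime_power rP co.
by rewrite imset_f ?inE.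
Qed.

Theorem corollary1p6 (n : nat) (hn : (4 <= n)%N) :
  ((#|rational_conj_classes 'Alt_('I_n)|%:Z
     = (cl 'Alt_('I_n))%:Z - 2 * (q n)%:Z + 2 * (delta n)%:Z)
   /\
   (#|rational_classes 'Alt_('I_n)|%:Z
     = (cl 'Alt_('I_n))%:Z - (q n)%:Z + (delta n)%:Z))%R.
Proof.
have iA : (#|'Sym_('I_n) : 'Alt_('I_n)| = 2)%g.
  by rewrite Alt_index // card_ord (leq_trans _ hn).
have Ec := card_rational_conj_classes (Alt_normal _) iA (fun g m _ => @alt_power_conj _ g m).
have Er := card_rational_classes (Alt_normal _) iA (fun g m _ => @alt_power_conj _ g m).
rewrite card_irrational_Sym_classes in Ec Er.
have := delta_nonsquare n; move: Ec Er; set k := #|_|.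
lia.
Qed.
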